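(* Let $H$ be a graph containing at most four vertices, and let $k \geq 5$ be fixed. There is a finite number (up to isomorphism) of $k$-vertex-critical $H$-free graphs if and only if $H$ is (isomorphic to) an induced subgraph of $\overline{K_4}$, $P_4$, $P_2+2P_1$, or $P_3+P_1$.
   Context: All graphs are finite, simple and undirected, with at least one vertex. A graph $G$ is $H$-free if it does not contain $H$ as an induced subgraph. A graph $G$ is $k$-vertex-critical if $\chi(G)=k$ but $\chi(G-v)<k$ for every vertex $v$ of $G$, where $\chi$ is the chromatic number and $G-v$ is obtained from $G$ by deleting $v$ and its incident edges. $K_t$ is the complete graph on $t$ vertices, $P_t$ is the path on $t$ vertices, $\overline{G}$ is the complement of $G$, $G+H$ is the disjoint union of $G$ and $H$, and $\ell G$ is the disjoint union of $\ell$ copies of $G$. Numbers of graphs are counted up to isomorphism. *)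

(* Defs.v *)
From mathcomp Require Import all_boot.

Set Implicit Arguments.
Unset Strict Implicit.
Unset Printing Implicit Defensive.

(* Finite simple graphs. The empty graph is allowed, so that deleting the only
   vertex of a graph makes sense; nonemptiness is assumed where it matters. *)
Record sgraph := SGraph {
  svertex :> finType;
  sedge : rel svertex;
  sedge_sym : symmetric sedge;
  sedge_irr : irreflexive sedge
}.

Notation "x -- y" := (sedge x y) (at level 30).

Definition isomorphic (G H : sgraph) : Prop :=
  exists2 f : G -> H, bijective f & {mono f : x y / x -- y}.

Section Induced.
Variables (G : sgraph) (S : {set G}).

Definition induced_edge : rel {x : G | x \in S} :=
  fun x y => val x -- val y.

Lemma induced_edge_sym : symmetric induced_edge.
Proof. by move=> x y; apply: sedge_sym. Qed.

Lemma induced_edge_irr : irreflexive induced_edge.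
Proof. by move=> x; apply: sedge_irr. Qed.

Definition induced : sgraph := SGraph induced_edge_sym induced_edge_irr.
End Induced.

Definition del_vertex (G : sgraph) (v : G) : sgraph := induced [set~ v].

Definition is_induced_subgraph (H G : sgraph) : Prop :=
  exists S : {set G}, isomorphic H (induced S).

Definition is_free (H G : sgraph) : Prop := ~ is_induced_subgraph H G.

Definition proper_coloring (G : sgraph) (k : nat) (c : {ffun G -> 'I_k}) : bool :=
  [forall x : G, forall y : G, (x -- y) ==> (c x != c y)].

Definition colorable (G : sgraph) (k : nat) : bool :=
  [exists c : {ffun G -> 'I_k}, proper_coloring c].

Lemma ex_colorable (G : sgraph) : exists k, colorable G k.
Proof.
exists #|G|; apply/existsP; exists [ffun x => enum_rank x].
apply/forallP=> x; apply/forallP=> y; apply/implyP=> xy; rewrite !ffunE.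
by apply: contraTneq xy => /enum_rank_inj ->; rewrite sedge_irr.
Qed.

Definition chromatic_number (G : sgraph) : nat := ex_minn (ex_colorable G).

Definition vertex_critical (k : nat) (G : sgraph) : Prop :=
  chromatic_number G = k /\ forall v : G, chromatic_number (del_vertex v) < k.

Definition finitely_many_up_to_iso (P : sgraph -> Prop) : Prop :=
  exists (n : nat) (F : 'I_n -> sgraph),
    forall G, P G -> exists i, isomorphic G (F i).

Section Complete.
Variable n : nat.

Definition complete_edge : rel 'I_n := fun x y => x != y.

Lemma complete_edge_sym : symmetric complete_edge.
Proof. by move=> x y; rewrite /complete_edge eq_sym. Qed.

Lemma complete_edge_irr : irreflexive complete_edge.
Proof. by move=> x; rewrite /complete_edge eqxx. Qed.

Definition complete_graph : sgraph := SGraph complete_edge_sym complete_edge_irr.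
End Complete.

Section Path.
Variable n : nat.

Definition path_edge : rel 'I_n :=
  fun x y => (x.+1 == y :> nat) || (y.+1 == x :> nat).

Lemma path_edge_sym : symmetric path_edge.
Proof. by move=> x y; rewrite /path_edge orbC. Qed.

Lemma path_edge_irr : irreflexive path_edge.
Proof. by move=> x; rewrite /path_edge orbb gtn_eqF. Qed.

Definition path_graph : sgraph := SGraph path_edge_sym path_edge_irr.
End Path.

Section Complement.
Variable G : sgraph.

Definition compl_edge : rel G := fun x y => (x != y) && ~~ (x -- y).

Lemma compl_edge_sym : symmetric compl_edge.
Proof. by move=> x y; rewrite /compl_edge eq_sym sedge_sym. Qed.

Lemma compl_edge_irr : irreflexive compl_edge.
Proof. by move=> x; rewrite /compl_edge eqxx. Qed.

Definition compl_graph : sgraph := SGraph compl_edge_sym compl_edge_irr.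
End Complement.

Section DisjointUnion.
Variables G H : sgraph.

Definition union_edge : rel (G + H)%type := fun u v =>
  match u, v with
  | inl x, inl y => x -- y
  | inr x, inr y => x -- y
  | _, _ => false
  end.

Lemma union_edge_sym : symmetric union_edge.
Proof. by case=> x [] y //=; apply: sedge_sym. Qed.

Lemma union_edge_irr : irreflexive union_edge.
Proof. by case=> x /=; apply: sedge_irr. Qed.

Definition disjoint_union : sgraph := SGraph union_edge_sym union_edge_irr.
End DisjointUnion.

Section Copies.
Variables (l : nat) (G : sgraph).

Definition copies_edge : rel ('I_l * G)%type :=
  fun u v => (u.1 == v.1) && (u.2 -- v.2).

Lemma copies_edge_sym : symmetric copies_edge.
Proof. by move=> u v; rewrite /copies_edge eq_sym sedge_sym. Qed.

Lemma copies_edge_irr : irreflexive copies_edge.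
Proof. by move=> u; rewrite /copies_edge sedge_irr andbF. Qed.

Definition copies : sgraph := SGraph copies_edge_sym copies_edge_irr.
End Copies.

(* Main.v *)
Require Import Defs.
From mathcomp Require Import all_boot zify.

(** Write k = q + 1 with q >= 4. A class of graphs is finite up to isomorphism
    exactly when its members have bounded order (finitely_manyP). Graphs free
    of an induced subgraph of F are F-free, so finiteness for F passes to every
    induced subgraph of F. It therefore suffices to bound the order for the
    four maximal graphs in the list and to find, for each minimal graph outside
    it, critical graphs of unbounded order. The minimal graphs on at most four
    vertices that embed in none of the four are K_3, 2P_2, C_4 and the claw
    (small_graph_dichotomy, a finite computation).

    Bounds. A (q+1)-colourable graph whose independent sets have at most a
    elements has at most (q+1)a vertices, so it is enough to bound independent
    sets; for co-K_4 the bound is 3. Criticality enters through one principle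
    (critical_color_seen): in any q-colouring of G - v the vertex v has
    neighbours of all q colours.
    - P_2+2P_1: delete a vertex s of an independent set with q + 2 elements.
      Two of the others, t and u, share a colour; s has a neighbour w of that
      colour, and s, w, t, u induce P_2+2P_1. So independent sets have at most
      q + 1 elements.
    - P_3+P_1: independent sets have at most 2 elements. In a larger one S, a
      neighbour of s is either private to s or complete to S. The private
      neighbours of b together with b form a clique, and every vertex complete
      to S is complete to this clique. Choose s with no more private neighbours
      than b; then some colour on the clique of b is missing from the private
      neighbours of s, hence from all neighbours of s.
    - P_4: such graphs are perfect, because a maximal independent set meets
      every maximal clique (P4_free_colorable), so a critical one is complete.

    Constructions. A graph that is not q-colourable, but whose vertex sets of
    size at most N all are, contains a (q+1)-vertex-critical induced subgraph
    with more than N vertices (critical_induced_subgraph).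
    - On 0, ..., qp join i and j when |i - j| belongs to a set D that contains
      1, ..., q - 1 and qp. Windows of q consecutive vertices are cliques, so a
      q-colouring has period q and gives 0 and qp the same colour although they
      are adjacent. If every member of D other than 1 and qp has residue at
      least 2 modulo q, the colouring by residues becomes proper once any vertex
      is removed and the later ones are shifted down by one. The smallest such D
      gives graphs without C_4 or claw once p >= 3, the largest gives graphs
      without 2P_2 (this is where q >= 4 is used).
    - For K_3, delete edges of a shift graph until deleting one more makes it
      q-colourable; the ends x and y of that last edge get equal colours in
      every q-colouring of the rest. A chain of copies without xy, with y of
      each copy glued to x of the next and an edge joining the two ends of the
      chain, is again triangle-free and not q-colourable, but removing one
      whole copy makes it q-colourable. *)

Set Implicit Arguments.
Unset Strict Implicit.
Unset Printing Implicit Defensive.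

(** * Induced subgraphs and finiteness up to isomorphism *)

Lemma induced_subgraphP (H G : sgraph) :
  is_induced_subgraph H G <->
  exists2 f : H -> G, injective f & {mono f : x y / x -- y}.
Proof.
split=> [[S [f [g fK gK] fe]]|[f finj fe]].
  exists (fun x => val (f x)) => [x y /val_inj /(can_inj fK) //|x y].
  by rewrite -(fe x y).
pose S := [set f x | x : H].
have fS x : f x \in S by apply/imset_f.
exists S; exists (fun x => exist _ (f x) (fS x) : induced S) => [|x y].
  apply: inj_card_bij => [x y [/finj] //|].
  by rewrite card_sig card_imset.
exact: fe.
Qed.

Lemma induced_subgraph_trans (G1 G2 G3 : sgraph) :
  is_induced_subgraph G1 G2 -> is_induced_subgraph G2 G3 ->
  is_induced_subgraph G1 G3.
Proof.
move=> /induced_subgraphP[f fi fe] /induced_subgraphP[g gi ge].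
apply/induced_subgraphP; exists (g \o f); first exact: inj_comp.
by move=> x y /=; rewrite ge fe.
Qed.

Lemma induced_is_induced_subgraph (G : sgraph) (S : {set G}) :
  is_induced_subgraph (induced S) G.
Proof. by apply/induced_subgraphP; exists val => //; apply: val_inj. Qed.

(** Symmetric irreflexive closure: lets a graph be described by arcs given in
    one direction only. *)
Definition arc_edge (V : finType) (a : rel V) : rel V :=
  fun x y => (x != y) && (a x y || a y x).

Lemma arc_edge_sym (V : finType) (a : rel V) : symmetric (arc_edge a).
Proof. by move=> x y; rewrite /arc_edge eq_sym orbC. Qed.

Lemma arc_edge_irr (V : finType) (a : rel V) : irreflexive (arc_edge a).
Proof. by move=> x; rewrite /arc_edge eqxx. Qed.

Definition arc_graph (V : finType) (a : rel V) : sgraph :=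
  SGraph (arc_edge_sym a) (arc_edge_irr a).

(** There are finitely many graphs of order at most N because each is coded by
    a set of vertices and a set of arcs inside 'I_N. *)
Lemma finitely_manyP (P : sgraph -> Prop) :
  finitely_many_up_to_iso P <-> exists N, forall G, P G -> #|G| <= N.
Proof.
split=> [[n [F PF]]|[N PN]].
  exists (\max_(i < n) #|F i|) => G /PF[i [f fbij _]].
  by rewrite (bij_eq_card fbij) (leq_bigmax i).
pose code := ({set 'I_N} * {set 'I_N * 'I_N})%type.
pose F (u : code) := @induced (arc_graph (fun x y => (x, y) \in u.2)) u.1.
exists #|{: code}|, (fun i => F (enum_val i)) => G /PN GN.
pose f (x : G) : 'I_N := widen_ord GN (enum_rank x).
have f_inj : injective f by move=> x y [] /val_inj/enum_rank_inj.
pose E := [set u | [exists x, [exists y, (x -- y) && (u == (f x, f y))]]].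
have inE x y : ((f x, f y) \in E) = (x -- y).
  rewrite inE; apply/existsP/idP => [[x' /existsP[y' /andP[xy]]]|xy].
    by rewrite xpair_eqE => /andP[/eqP/f_inj-> /eqP/f_inj->].
  by exists x; apply/existsP; exists y; rewrite xy eqxx.
have [S GS] : is_induced_subgraph G (arc_graph (fun x y => (x, y) \in E)).
  apply/induced_subgraphP; exists f => // x y /=.
  rewrite /arc_edge !inE (inj_eq f_inj) [y -- x]sedge_sym orbb.
  by case: eqP => // ->; rewrite sedge_irr.
by exists (enum_rank ((S, E) : code)); rewrite /F enum_rankK.
Qed.

(** * Colourings and vertex-criticality *)

(** Colours are natural numbers rather than ordinals, so that colourings can
    be restricted, extended and recoloured without any case split on q = 0. *)
Definition colorable_on (G : sgraph) (S : {set G}) (q : nat) : Prop :=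
  exists2 c : G -> nat,
    {in S, forall x, c x < q} & {in S &, forall x y, x -- y -> c x <> c y}.

Lemma colorable_inducedP (G : sgraph) (S : {set G}) (q : nat) :
  colorable (induced S) q <-> colorable_on S q.
Proof.
split=> [/existsP[c /forallP cP]|[c cS cP]].
  pose d x := if insub x is Some u then val (c (u : {x | x \in S})) else 0.
  have dE x (xS : x \in S) : d x = c (Sub x xS) by rewrite /d insubT.
  exists d => [x xS|x y xS yS xy]; rewrite !dE // => /val_inj/eqP; apply/negP.
  exact: (implyP (forallP (cP _) _)).
apply/existsP; exists [ffun u : induced S => Ordinal (cS _ (valP u))].
apply/forallP=> u; apply/forallP=> v; apply/implyP=> uv; rewrite !ffunE.
by apply/eqP=> -[]; apply: cP uv; apply: valP.
Qed.

Lemma colorableP (G : sgraph) (q : nat) :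
  colorable G q <-> colorable_on [set: G] q.
Proof.
split=> [/existsP[c /forallP cP]|[c cS cP]].
  exists (fun x => nat_of_ord (c x)) => // x y _ _ xy /val_inj/eqP; apply/negP.
  exact: (implyP (forallP (cP _) _)).
apply/existsP; exists [ffun x => Ordinal (cS _ (in_setT x))].
apply/forallP=> u; apply/forallP=> v; apply/implyP=> uv; rewrite !ffunE.
by apply/eqP=> -[]; apply: cP uv; rewrite in_setT.
Qed.

Lemma colorable_on_mono (G : sgraph) (S T : {set G}) p q :
  S \subset T -> p <= q -> colorable_on T p -> colorable_on S q.
Proof.
move=> /subsetP ST pq [c cT cP]; exists c => [x /ST/cT cx|x y /ST xT /ST yT].
  exact: leq_trans cx pq.
exact: cP.
Qed.

Lemma chromatic_number_leq (G : sgraph) q :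
  chromatic_number G <= q <-> colorable_on [set: G] q.
Proof.
rewrite /chromatic_number; case: ex_minnP => m mP mmin.
split=> [mq|/colorableP/mmin //].
by apply: colorable_on_mono mq _ => //; apply/colorableP.
Qed.

Lemma chromatic_number_induced_leq (G : sgraph) (S : {set G}) q :
  chromatic_number (induced S) <= q <-> colorable_on S q.
Proof.
split; first by move/chromatic_number_leq/colorableP/colorable_inducedP.
by move/colorable_inducedP/colorableP/chromatic_number_leq.
Qed.

Lemma colorable_on_setU1 (G : sgraph) (S : {set G}) v q :
  colorable_on (S :\ v) q -> colorable_on S q.+1.
Proof.
move=> [c cS cP]; exists (fun x => if x == v then q else c x).
  move=> x xS; case: eqP => // /eqP xv.
  by rewrite ltnS ltnW // cS // !inE xv.
move=> x y xS yS xy.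
case: (eqVneq x v) => [xv|xv]; case: (eqVneq y v) => [yv|yv].
- by rewrite xv yv sedge_irr in xy.
- by have := cS y; rewrite !inE yv yS => /(_ isT); lia.
- by have := cS x; rewrite !inE xv xS => /(_ isT); lia.
by apply: cP => //; rewrite !inE ?xv ?yv.
Qed.

(** The chromatic number cannot exceed q + 1, since a q-colouring of G - v
    extends by giving v a new colour. *)
Lemma vertex_criticalP (G : sgraph) q :
  vertex_critical q.+1 G <->
  ~ colorable_on [set: G] q /\ forall v : G, colorable_on [set~ v] q.
Proof.
split=> [[chiG Gcrit]|[Gq Gcrit]].
  split=> [/chromatic_number_leq|v]; first by rewrite chiG ltnn.
  by apply/chromatic_number_induced_leq; rewrite -ltnS Gcrit.
split=> [|v]; last by rewrite ltnS; apply/chromatic_number_induced_leq.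
apply/eqP; rewrite eqn_leq; apply/andP; split; last first.
  by rewrite ltnNge; apply/negP=> /chromatic_number_leq.
apply/chromatic_number_leq.
case: (pickP (mem [set: G])) => [v _|G0].
  by apply: (colorable_on_setU1 (v := v)); rewrite setTD.
by exists (fun=> 0) => x; have := G0 x; rewrite /= inE.
Qed.

(** Otherwise v could take the colour a and G would be q-colourable. *)
Lemma critical_color_seen (G : sgraph) q (v : G) (c : G -> nat) a :
  vertex_critical q.+1 G -> {in [set~ v], forall x, c x < q} ->
  {in [set~ v] &, forall x y, x -- y -> c x <> c y} -> a < q ->
  exists2 w, v -- w & c w = a.
Proof.
move=> /vertex_criticalP[Gq _] cq cP aq.
have [/existsP[w /andP[vw /eqP cw]]|] :=
  boolP [exists w, (v -- w) && (c w == a)].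
  by exists w.
rewrite negb_exists => /forallP none; case: Gq.
have seen x : v -- x -> a <> c x.
  by move=> vx ca; have := none x; rewrite vx ca eqxx.
exists (fun x => if x == v then a else c x) => [x _|x y _ _ xy].
  by case: eqP => // /eqP xv; apply: cq; rewrite !inE.
case: (eqVneq x v) => [xv|xv]; case: (eqVneq y v) => [yv|yv].
- by rewrite xv yv sedge_irr in xy.
- by rewrite xv in xy; apply: seen.
- by rewrite yv sedge_sym in xy => /esym; apply: seen.
by apply: cP; rewrite ?inE.
Qed.

(** A vertex set minimal among those that are not q-colourable induces a
    critical graph, and by assumption it is large. *)
Lemma critical_induced_subgraph (G : sgraph) N q :
  ~ colorable_on [set: G] q ->
  (forall S : {set G}, #|S| <= N -> colorable_on S q) ->
  exists2 S : {set G}, N < #|S| & vertex_critical q.+1 (induced S).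
Proof.
move=> Gq small.
have [S] : {S : {set G} |
    minset (fun S : {set G} => ~~ colorable (induced S) q) S}.
  have [//|S ? _] := @minset_exists _
    (fun S : {set G} => ~~ colorable (induced S) q) [set: G] _;
    last by exists S.
  by apply/negP=> /colorable_inducedP.
move=> /minsetP[/negP Sq Smin]; exists S.
  by rewrite ltnNge; apply/negP=> /small/colorable_inducedP.
apply/vertex_criticalP; split=> [/colorableP //|v].
have : colorable_on (S :\ val v) q.
  apply/colorable_inducedP.
  have [//|/Smin/(_ (subsetDl _ _)) SS] := boolP (colorable _ q).
  by have /setP/(_ (val v)) := SS; rewrite !inE eqxx (valP v).
case=> c cS cP; exists (fun x => c (val x)) => [x|x y].
  by rewrite !inE => xv; apply: cS; rewrite !inE (valP x) andbT.
by rewrite !inE => xv yv; apply: cP; rewrite !inE (valP x, valP y) andbT.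
Qed.

Lemma unbounded_critical (F : sgraph) q :
  (forall N, exists G, [/\ is_free F G, ~ colorable_on [set: G] q &
     forall S : {set G}, #|S| <= N -> colorable_on S q]) ->
  ~ finitely_many_up_to_iso (fun G => vertex_critical q.+1 G /\ is_free F G).
Proof.
move=> big /finitely_manyP[N Nmax].
have [G [FG Gq small]] := big N.
have [S NS Scrit] := critical_induced_subgraph Gq small.
have /Nmax : vertex_critical q.+1 (induced S) /\ is_free F (induced S).
  split=> // FS; apply: FG.
  exact: induced_subgraph_trans FS (induced_is_induced_subgraph S).
by rewrite /= card_sig leqNgt NS.
Qed.

(** * Adjacency matrices and four-vertex graphs *)

Definition adjacency (G : sgraph) (s : seq G) : seq (seq bool) :=
  [seq [seq x -- y | y <- s] | x <- s].

Lemma adjacency_induced (H G : sgraph) (hs : seq H) (gs : seq G) :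
  (forall x, x \in hs) -> uniq gs -> adjacency hs = adjacency gs ->
  is_induced_subgraph H G.
Proof.
move=> hsP gs_uniq adj.
have sz : size hs = size gs by have := congr1 size adj; rewrite !size_map.
have nthE (T : sgraph) (t0 : T) (s : seq T) i j : i < size s -> j < size s ->
    nth false (nth [::] (adjacency s) i) j = nth t0 s i -- nth t0 s j.
  by move=> ilt jlt; rewrite /adjacency (nth_map t0) // (nth_map t0).
have lt x : index x hs < size gs by rewrite -sz index_mem.
case: gs sz adj gs_uniq lt => [|g0 gs'] => [_ _ _ lt|].
  apply/induced_subgraphP.
  have F : H -> False by move=> x; have := lt x.
  by exists (fun x => match F x with end) => x; case: (F x).
set gs := g0 :: gs' => sz adj gs_uniq lt.
apply/induced_subgraphP; exists (fun x => nth g0 gs (index x hs)) => [x y|x y].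
  move/eqP; rewrite nth_uniq // => /eqP e.
  by rewrite -(nth_index x (hsP x)) e nth_index.
by rewrite -nthE // -adj (nthE _ x) ?sz // !nth_index.
Qed.

(** The matrix of the vertices selected by the list of positions p. *)
Definition reindex (M : seq (seq bool)) (p : seq nat) : seq (seq bool) :=
  [seq [seq nth false (nth [::] M i) j | j <- p] | i <- p].

(** Initial segments of permutations of the positions run over all injective
    lists of positions, which makes the test computable. *)
Definition embeds (M N : seq (seq bool)) : bool :=
  has (fun p => reindex N (take (size M) p) == M)
    (permutations (iota 0 (size N))).

Lemma embedsP (H G : sgraph) (hs : seq H) (gs : seq G) :
  (forall x, x \in hs) -> uniq gs -> embeds (adjacency hs) (adjacency gs) ->
  is_induced_subgraph H G.
Proof.
move=> hsP gs_uniq /hasP[p0]; rewrite mem_permutations !size_map => pp.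
set p := take _ _ => /eqP pM.
have p_uniq : uniq p.
  by apply: take_uniq; rewrite (perm_uniq pp) iota_uniq.
have p_lt i : i \in p -> i < size gs.
  by move/mem_take; rewrite (perm_mem pp) mem_iota.
case: gs pp gs_uniq pM p_lt => [|g0 gs'].
  move=> /perm_size/size0nil p00 _ pM _.
  have := congr1 size pM; rewrite /p p00 !size_map => /esym/size0nil hs0.
  by apply: (@adjacency_induced _ _ hs [::]) => //; rewrite hs0.
move: (g0 :: gs') => gs pp gs_uniq pM p_lt.
apply: (@adjacency_induced _ _ hs [seq nth g0 gs i | i <- p]) => //.
  rewrite map_inj_in_uniq // => i j /p_lt ilt /p_lt jlt /eqP.
  by rewrite nth_uniq // => /eqP.
rewrite -pM /adjacency -map_comp; apply/eq_in_map => i /p_lt ilt /=.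
rewrite -map_comp; apply/eq_in_map => j /p_lt jlt /=.
by rewrite (nth_map g0) // (nth_map g0).
Qed.

Lemma uniq_size_card_mem (T : finType) (s : seq T) :
  uniq s -> size s = #|T| -> forall x, x \in s.
Proof.
move=> /card_uniqP <- cs x.
by rewrite (elimT (subset_cardP cs) (subset_predT _)).
Qed.

(** Ordinals whose bound is proved by computation, so that adjacency between
    listed vertices evaluates. *)
Notation "''o_' n i" := (@Ordinal n i isT)
  (at level 8, n at level 2, i at level 2).

Definition co_K4 : sgraph := compl_graph (complete_graph 4).
Definition P2_2P1 : sgraph :=
  disjoint_union (path_graph 2) (copies 2 (path_graph 1)).
Definition P3_P1 : sgraph := disjoint_union (path_graph 3) (path_graph 1).

Definition co_K4_seq : seq co_K4 := [:: 'o_4 0; 'o_4 1; 'o_4 2; 'o_4 3].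
Definition P4_seq : seq (path_graph 4) := [:: 'o_4 0; 'o_4 1; 'o_4 2; 'o_4 3].
Definition P2_2P1_seq : seq P2_2P1 :=
  [:: inl 'o_2 0; inl 'o_2 1; inr ('o_2 0, 'o_1 0); inr ('o_2 1, 'o_1 0)].
Definition P3_P1_seq : seq P3_P1 :=
  [:: inl 'o_3 0; inl 'o_3 1; inl 'o_3 2; inr 'o_1 0].

Lemma mem_co_K4_seq x : x \in co_K4_seq.
Proof. by apply: uniq_size_card_mem; rewrite ?card_ord. Qed.

Lemma mem_P4_seq x : x \in P4_seq.
Proof. by apply: uniq_size_card_mem; rewrite ?card_ord. Qed.

Lemma mem_P2_2P1_seq x : x \in P2_2P1_seq.
Proof.
by apply: uniq_size_card_mem; rewrite ?card_sum ?card_prod ?card_ord.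
Qed.

Lemma mem_P3_P1_seq x : x \in P3_P1_seq.
Proof.
by apply: uniq_size_card_mem; rewrite ?card_sum ?card_prod ?card_ord.
Qed.

Definition edges (G : sgraph) (x y z w : G) : seq bool :=
  [:: x -- y; x -- z; x -- w; y -- z; y -- w; z -- w].

Lemma sedge_neq (G : sgraph) (x y : G) : x -- y -> x != y.
Proof. by apply: contraTneq => ->; rewrite sedge_irr. Qed.

(** * Bounded order when one of the four listed graphs is excluded *)

Definition independent (G : sgraph) (S : {set G}) : Prop :=
  {in S &, forall x y, ~~ (x -- y)}.

Definition clique (G : sgraph) (S : {set G}) : Prop :=
  {in S &, forall x y, x != y -> x -- y}.

Lemma edges_induced (H G : sgraph) (h0 h1 h2 h3 : H) (a b c d : G) :
  (forall x, x \in [:: h0; h1; h2; h3]) -> uniq [:: a; b; c; d] ->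
  edges a b c d = edges h0 h1 h2 h3 -> is_induced_subgraph H G.
Proof.
move=> hP abcd [e01 e02 e03 e12 e13 e23].
apply: (adjacency_induced hP abcd); rewrite /adjacency /= !sedge_irr.
rewrite e01 e02 e03 e12 e13 e23 [b -- a]sedge_sym [h1 -- h0]sedge_sym.
rewrite ![c -- _]sedge_sym ![h2 -- _]sedge_sym ![d -- _]sedge_sym.
by rewrite ![h3 -- _]sedge_sym !(e01, e02, e03, e12, e13, e23).
Qed.

Lemma co_K4_free_independent (G : sgraph) (S : {set G}) :
  is_free co_K4 G -> independent S -> #|S| <= 3.
Proof.
move=> GF Sind; rewrite leqNgt; apply/negP=> S4; apply: GF.
have S4e : size (take 4 (enum S)) = 4 by rewrite size_takel // -cardE.
have Su : uniq (take 4 (enum S)) by rewrite take_uniq ?enum_uniq.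
have ST x : x \in take 4 (enum S) -> x \in S.
  by move/mem_take; rewrite mem_enum.
case: (take 4 _) S4e ST Su => [|x [|y [|z [|w []]]]] // _ ST Su.
have nE u v : u \in [:: x; y; z; w] -> v \in [:: x; y; z; w] ->
    (u -- v) = false.
  by move=> /ST uS /ST vS; apply/negbTE/Sind.
by apply: (edges_induced mem_co_K4_seq Su); rewrite /edges !nE ?inE ?eqxx ?orbT.
Qed.

(** Distinctness of the vertices of a forbidden pattern mostly follows from
    their different neighbourhoods. *)
Lemma sedge_profile_neq (G : sgraph) (x y z : G) :
  x -- z -> ~~ (y -- z) -> x != y.
Proof. by move=> xz; apply: contraNneq => <-. Qed.

Lemma P2_2P1_freeF (G : sgraph) (a b c d : G) :
  is_free P2_2P1 G -> a -- b -> c != d -> ~~ (c -- d) ->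
  ~~ (a -- c) -> ~~ (a -- d) -> ~~ (b -- c) -> ~~ (b -- d) -> False.
Proof.
move=> GF ab cd /negbTE ncd nac nad nbc nbd; apply: GF.
apply: (@edges_induced _ _ _ _ _ _ a b c d mem_P2_2P1_seq).
  rewrite /= !inE !negb_or cd (sedge_neq ab) !andbT /= -!andbA.
  have ba : b -- a by rewrite sedge_sym.
  by rewrite !(sedge_profile_neq ab) ?(sedge_profile_neq ba) //= sedge_sym.
by rewrite /edges ab ncd !(negbTE nac, negbTE nad, negbTE nbc, negbTE nbd).
Qed.

Lemma P3_P1_freeF (G : sgraph) (a b c d : G) :
  is_free P3_P1 G -> a -- b -> b -- c -> a != c -> ~~ (a -- c) ->
  ~~ (a -- d) -> ~~ (b -- d) -> ~~ (c -- d) -> False.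
Proof.
move=> GF ab bc ac nac nad nbd ncd; apply: GF.
have [ba cb] : b -- a /\ c -- b by split; rewrite sedge_sym.
apply: (@edges_induced _ _ _ _ _ _ a b c d mem_P3_P1_seq).
  rewrite /= !inE !negb_or ac (sedge_neq ab) (sedge_neq bc) !andbT /=.
  by apply/and3P; split; [move: ab|move: ba|move: cb] => /sedge_profile_neq;
     apply; rewrite sedge_sym.
by rewrite /edges ab bc !(negbTE nac, negbTE nad, negbTE nbd, negbTE ncd).
Qed.

Lemma P4_freeF (G : sgraph) (a b c d : G) :
  is_free (path_graph 4) G -> a -- b -> b -- c -> c -- d ->
  ~~ (a -- c) -> ~~ (a -- d) -> ~~ (b -- d) -> False.
Proof.
move=> GF ab bc cd nac nad nbd; apply: GF.
have [ba dc] : b -- a /\ d -- c by split; rewrite sedge_sym.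
apply: (@edges_induced _ _ _ _ _ _ a b c d mem_P4_seq).
  rewrite /= !inE !negb_or (sedge_neq ab) (sedge_neq bc) (sedge_neq cd).
  rewrite !andbT /=.
  rewrite -!andbA [a == c]eq_sym [a == d]eq_sym.
  by apply/and3P; split; [move: cd|move: dc|move: ba] => /sedge_profile_neq;
     apply; rewrite // sedge_sym.
by rewrite /edges ab bc cd !(negbTE nac, negbTE nad, negbTE nbd).
Qed.

Lemma colorable_card_bound (G : sgraph) q a :
  colorable_on [set: G] q ->
  (forall S : {set G}, independent S -> #|S| <= a) -> #|G| <= q * a.
Proof.
case=> c cq cP Sa; rewrite -sum1_card.
pose d x : 'I_q := Ordinal (cq x (in_setT x)).
rewrite (partition_big d xpredT) //=.
rewrite -[q in q * a]card_ord -sum_nat_const; apply: leq_sum => i _.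
rewrite sum1_card; apply: leq_trans (Sa [set x | d x == i] _).
  by rewrite cardsE.
move=> x y; rewrite !inE => /eqP dx /eqP dy; apply/negP=> /cP.
by rewrite !inE => /(_ isT isT) []; rewrite -[c x]/(val (d x)) dx -dy.
Qed.

Lemma critical_colorable (G : sgraph) q :
  vertex_critical q G -> colorable_on [set: G] q.
Proof. by move=> [Gq _]; apply/chromatic_number_leq; rewrite Gq. Qed.

(** Pigeonhole: the colours of A are too many to all lie in the list s. *)
Lemma color_missing (T : finType) (c : T -> nat) (A : {set T}) (s : seq nat) :
  {in A &, injective c} -> size s < #|A| -> exists2 x, x \in A & c x \notin s.
Proof.
move=> cinj sA;
have [/existsP[x /andP[]]|] := boolP [exists x, (x \in A) && (c x \notin s)].
  by exists x.
rewrite negb_exists => /forallP none; move: sA; rewrite ltnNge => /negP[].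
rewrite cardE -(size_map c) uniq_leq_size //.
  rewrite map_inj_in_uniq ?enum_uniq // => x y.
  by rewrite !mem_enum; apply: cinj.
move=> _ /mapP[x xA ->]; rewrite mem_enum in xA.
by have := none x; rewrite xA negbK.
Qed.

Lemma color_pigeonhole (T : finType) (c : T -> nat) (A : {set T}) q :
  {in A, forall x, c x < q} -> q < #|A| ->
  exists x y, [/\ x \in A, y \in A, x != y & c x = c y].
Proof.
move=> cq qA.
have [/existsP[x /existsP[y /and4P[xA yA xy /eqP cxy]]]|none] :=
  boolP [exists x, [exists y, [&& x \in A, y \in A, x != y & c x == c y]]].
  by exists x, y.
have [x y xA yA cxy||x xA] := @color_missing _ c A (iota 0 q); last 1 first.
- by rewrite mem_iota cq.
- apply/eqP; apply: contraNT none => xy; apply/existsP; exists x.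
  by apply/existsP; exists y; rewrite xA yA xy cxy eqxx.
by rewrite size_iota.
Qed.

(** If a member s of S is deleted, two other members share a colour; a
    neighbour of s with that colour completes an induced P_2+2P_1. *)
Lemma P2_2P1_free_critical_independent (G : sgraph) q (S : {set G}) :
  vertex_critical q.+1 G -> is_free P2_2P1 G -> independent S -> #|S| <= q.+1.
Proof.
move=> Gcrit GF Sind; rewrite leqNgt; apply/negP=> Sbig.
have /card_gt0P[s sS] : 0 < #|S| by apply: leq_trans Sbig.
have [c cq cP] := (proj1 (vertex_criticalP G q) Gcrit).2 s.
have Ss x : x \in S :\ s -> x \in [set~ s] by rewrite !inE => /andP[].
have [||t [u [tS uS tu ctu]]] := @color_pigeonhole _ c (S :\ s) q.
- by move=> x /Ss /cq.
- by move: Sbig; rewrite (cardsD1 s) sS.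
have [v sv cv] := critical_color_seen Gcrit cq cP (cq _ (Ss _ tS)).
have vs : v \in [set~ s] by rewrite !inE eq_sym sedge_neq.
have vN x : x \in S :\ s -> c x = c t -> ~~ (v -- x).
  by move=> xS cx; apply/negP=> /cP; rewrite vs Ss // cx cv; case.
move: (tS) (uS); rewrite !inE => /andP[_ tS'] /andP[_ uS'].
by apply: (P2_2P1_freeF GF sv tu);
   [exact: Sind|exact: Sind|exact: Sind|exact: vN|exact: vN (esym ctu)].
Qed.

(** A q-colouring of G - s leaves a colour free for s when s has, among the
    members of S, no more private neighbours than b: the clique formed by b and
    its private neighbours then carries a colour absent from the private
    neighbours of s, and the remaining neighbours of s, being adjacent to this
    whole clique, avoid that colour too. *)
Lemma P3_P1_free_critical_independent (G : sgraph) q (S : {set G}) :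
  vertex_critical q.+1 G -> is_free P3_P1 G -> independent S -> #|S| <= 2.
Proof.
move=> Gcrit GF Sind; rewrite leqNgt; apply/negP=> S3.
pose priv s := [set x | (s -- x) && [forall t in S, (t -- x) ==> (t == s)]].
have privE s t x : x \in priv s -> t \in S -> t != s -> ~~ (t -- x).
  rewrite inE => /andP[_ /forall_inP sx] tS.
  by apply: contraNN => /(implyP (sx t tS)).
(* S has at least three elements, which leaves a further vertex for each
   forbidden pattern. *)
have third s t : exists2 u, u \in S & (u != s) && (u != t).
  have /card_gt0P[u] : 0 < #|S :\: [set s; t]|.
    rewrite cardsD subn_gt0; apply: leq_ltn_trans S3.
    apply: leq_trans (subset_leq_card (subsetIr _ _)) _.
    by rewrite cards2; case: eqP.
  by rewrite !inE negb_or => /andP[? ?]; exists u.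
(* A neighbour of s and of t that misses u in S would give s - d - t with u
   isolated. *)
have full s d :
    s \in S -> s -- d -> d \notin priv s -> {in S, forall t, t -- d}.
  move=> sS sd; rewrite inE sd negb_forall /= => /existsP[t].
  rewrite !negb_imply => /and3P[tS td ts] u uS; apply: contraT => ud.
  have dt : d -- t by rewrite sedge_sym.
  by case: (P3_P1_freeF (d := u) GF sd dt);
    [rewrite eq_sym|exact: Sind|exact: Sind|rewrite sedge_sym|exact: Sind].
have [s [b [sS bS sb]]] : exists s b,
    [/\ s \in S, b \in S, s != b & #|priv s| <= #|priv b|].
  have /card_gt0P[s sS] : 0 < #|S| by apply: leq_trans S3.
  have [t tS /andP[ts _]] := third s s.
  have [st|ts'] := leqP #|priv s| #|priv t|.
    by exists s, t; rewrite eq_sym.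
  by exists t, s; split=> //; apply: ltnW.
move=> sb_le.
have [c cq cP] := (proj1 (vertex_criticalP G q) Gcrit).2 s.
have Bs x : x \in b |: priv b -> x != s.
  rewrite !inE => /predU1P[->|/andP[bx _]]; first by rewrite eq_sym.
  by apply: contraTneq bx => ->; exact: Sind.
(* b and its private neighbours form a clique: non-adjacent x and y would give
   x - b - y with t isolated. *)
have cinj : {in b |: priv b &, injective c}.
  move=> x y xB yB cxy; apply/eqP; apply: contraT => xy.
  have := cP x y; rewrite !inE !Bs // cxy => /(_ isT isT) xyN.
  case: xyN => //; move: xB yB xy; rewrite !in_setU1.
  move=> /predU1P[->|xb] /predU1P[->|yb]; rewrite ?eqxx //.
  - by move: yb; rewrite inE => /andP[].
  - by move: xb; rewrite inE sedge_sym => /andP[].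
  move=> xy; have [t tS /andP[tb _]] := third b b.
  have [bx bY] : b -- x /\ b -- y.
    by move: xb yb; rewrite !inE => /andP[-> _] /andP[].
  rewrite sedge_sym in bx.
  apply: contraT => xyN; case: (P3_P1_freeF (d := t) GF bx bY xy xyN).
  - by rewrite sedge_sym (privE b).
  - exact: Sind.
  - by rewrite sedge_sym (privE b).
have [y yB cy] :
    exists2 y, y \in b |: priv b & c y \notin map c (enum (priv s)).
  apply: color_missing => //; rewrite size_map -cardE cardsU1.
  by rewrite [b \in _]inE sedge_irr add1n ltnS.
have ys : y \in [set~ s] by rewrite !inE Bs.
have [w sw cw] := critical_color_seen Gcrit cq cP (cq _ ys).
have ws : w \in [set~ s] by rewrite !inE eq_sym sedge_neq.
have wpriv : w \notin priv s.
  by apply: contra cy => wp; rewrite -cw map_f // mem_enum.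
(* w is complete to S, hence adjacent to y: otherwise s - w - u with y
   isolated, as y is private to b. *)
have wS := full _ _ sS sw wpriv.
case: (negP (introN idP (fun wy => cP w y ws ys wy cw))).
move: yB; rewrite in_setU1 => /predU1P[->|yb]; first by rewrite sedge_sym wS.
have [u uS /andP[us ub]] := third s b.
have wu : w -- u by rewrite sedge_sym wS.
apply: contraT => wy; case: (P3_P1_freeF (d := y) GF sw wu) => //.
- by rewrite eq_sym.
- exact: Sind.
- exact: (privE b).
- exact: (privE b).
Qed.

(** Colour a maximal independent set I of S with one colour. A clique Q
    disjoint from I has a common neighbour in I: take u in I with the most
    neighbours in Q; if u misses x in Q, then a neighbour v of x in I
    misses some neighbour y of u in Q, and u, y, x, v is an induced P_4. So
    removing I lowers the clique number, and induction applies. *)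
Lemma P4_free_colorable (G : sgraph) q (S : {set G}) :
  is_free (path_graph 4) G ->
  (forall Q : {set G}, Q \subset S -> clique Q -> #|Q| <= q) ->
  colorable_on S q.
Proof.
move=> GF; elim: q S => [|q IHq] S Sq.
  have S0 x : x \in S -> False.
    move=> xS; have cl : clique [set x].
      by move=> y z; rewrite !inE => /eqP-> /eqP->; rewrite eqxx.
    by have := Sq [set x]; rewrite sub1set cards1 => /(_ xS cl).
  by exists (fun=> 0) => [x xS|x y xS]; case: (S0 x xS).
pose indep (I : {set G}) :=
  (I \subset S) && [forall x in I, forall y in I, ~~ (x -- y)].
have [I /maxsetP[/andP[IS /forall_inP Iind] Imax]] : {I | maxset indep I}.
  have [|I ? _] := @maxset_exists _ indep set0; last by exists I.
  by rewrite /indep sub0set; apply/forall_inP=> x; rewrite inE.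
have {}Iind x y : x \in I -> y \in I -> ~~ (x -- y).
  by move=> /Iind/forall_inP; apply.
have dom x : x \in S -> x \notin I -> exists2 u, u \in I & u -- x.
  move=> xS xI.
  have [/existsP[u /andP[? ?]]|] := boolP [exists u, (u \in I) && (u -- x)].
    by exists u.
  rewrite negb_exists => /forallP none; case/negP: xI.
  have nI u : u \in I -> ~~ (u -- x) by move=> uI; have := none u; rewrite uI.
  have /Imax/(_ (subsetUr _ _)) <- : indep (x |: I); last by rewrite setU11.
  rewrite /indep subUset sub1set xS IS; apply/forall_inP=> u.
  rewrite !inE => uI; apply/forall_inP=> v; rewrite !inE => vI.
  case/predU1P: uI => [->|uI]; case/predU1P: vI => [->|vI].
  - by rewrite sedge_irr.
  - by rewrite sedge_sym nI.
  - exact: nI.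
  exact: Iind.
have [c cq cP] : colorable_on (S :\: I) q.
  apply: IHq => Q QSI Qcl.
  have [->|[x0 x0Q]] := set_0Vmem Q; first by rewrite cards0.
  have QS x : x \in Q -> x \in S by move/(subsetP QSI); rewrite inE => /andP[].
  have QI x : x \in Q -> x \notin I.
    by move/(subsetP QSI); rewrite inE => /andP[].
  have [u0 u0I _] := dom _ (QS _ x0Q) (QI _ x0Q).
  case: (arg_maxnP (fun u => #|[set x in Q | u -- x]|) u0I) => u uI umax.
  have uQ x : x \in Q -> u -- x.
    move=> xQ; apply: contraT => ux.
    have [v vI vx] := dom _ (QS _ xQ) (QI _ xQ).
    have [y /andP[yQ uy] vy] : exists2 y, (y \in Q) && (u -- y) & ~~ (v -- y).
      have [/existsP[y /andP[? ?]]|] :=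
        boolP [exists y, ((y \in Q) && (u -- y)) && ~~ (v -- y)].
        by exists y.
      rewrite negb_exists => /forallP none; have := umax v vI.
      rewrite /= leqNgt => /negP[]; apply: proper_card; apply/properP; split.
        apply/subsetP=> y; rewrite !inE => yQ.
        have := none y; rewrite yQ negbK /=.
        by move=> ->; case/andP: yQ => ->.
      by exists x; rewrite !inE xQ ?vx.
    have xy : x != y by apply: contraNneq ux => ->.
    have yx : y -- x by rewrite sedge_sym Qcl.
    have xv : x -- v by rewrite sedge_sym.
    by case: (P4_freeF GF uy yx xv ux (Iind _ _ uI vI)); rewrite sedge_sym.
  have := Sq (u |: Q); rewrite cardsU1 (contraL (QI u) uI) ltnS; apply.
    by rewrite subUset sub1set (subsetP IS) //=; apply/subsetP.
  move=> x y; rewrite !in_setU1.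
  case/predU1P=> [->|xQ] /predU1P[->|yQ]; rewrite ?eqxx //.
  - by rewrite uQ.
  - by rewrite sedge_sym uQ.
  exact: Qcl.
exists (fun x => if x \in I then q else c x) => [x xS|x y xS yS xy].
  by case: ifPn => // xI; rewrite ltnS ltnW // cq // inE xI.
have cqn z : z \in S -> z \notin I -> c z <> q.
  by move=> zS zI; have := cq z; rewrite inE zI zS => /(_ isT); lia.
case: ifPn => xI; case: ifPn => yI.
- by have := Iind _ _ xI yI; rewrite xy.
- by move/esym; apply: cqn.
- exact: cqn.
by apply: cP => //; rewrite inE ?xI ?yI.
Qed.

Lemma clique_card_colorable (G : sgraph) q (Q : {set G}) :
  clique Q -> colorable_on Q q -> #|Q| <= q.
Proof.
move=> Qcl [c cq cP]; rewrite leqNgt; apply/negP.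
move=> /(color_pigeonhole cq)[x [y [xQ yQ xy cxy]]].
by apply: (cP x y) => //; apply: Qcl.
Qed.

(** A critical graph that is not q-colourable contains a clique on more than q
    vertices, and deleting any vertex destroys all of those, so the clique is
    everything. *)
Lemma P4_free_critical_card (G : sgraph) q :
  vertex_critical q.+1 G -> is_free (path_graph 4) G -> #|G| <= q.+1.
Proof.
move=> /[dup] /critical_colorable Gq1 /vertex_criticalP[Gq Gcrit] GF.
have [/existsP[Q /andP[/forall_inP Qcl qQ]]|] :=
  boolP [exists Q : {set G},
    [forall x in Q, forall y in Q, (x != y) ==> (x -- y)] && (q < #|Q|)].
  have {}Qcl : clique Q.
    by move=> x y /Qcl/forall_inP Qx /Qx/implyP.
  suff QT : Q = setT.
    by rewrite -cardsT -QT clique_card_colorable // QT.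
  apply/setP=> v; rewrite inE; apply: contraTT qQ => vQ; rewrite -leqNgt.
  apply: clique_card_colorable => //; apply: colorable_on_mono (Gcrit v) => //.
  by apply/subsetP=> x xQ; rewrite !inE; apply: contraNneq vQ => <-.
rewrite negb_exists => /forallP none; case: Gq.
apply: P4_free_colorable => // Q _ Qcl.
have := none Q; rewrite negb_and -leqNgt; case/orP=> // /negP[].
by apply/forall_inP=> x xQ; apply/forall_inP=> y yQ; apply/implyP; apply: Qcl.
Qed.

(** The common bound (q+1)(q+3) is crude: it covers independence number at
    most q + 3, hence all four cases. *)
Lemma finitely_many_free_critical (F : sgraph) q :
  [\/ F = co_K4, F = path_graph 4, F = P2_2P1 | F = P3_P1] ->
  finitely_many_up_to_iso (fun G => vertex_critical q.+1 G /\ is_free F G).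
Proof.
move=> Fgood; apply/finitely_manyP; exists (q.+1 * q.+3) => G [Gcrit GF].
have Gq := critical_colorable Gcrit.
have small a : a <= q.+3 -> (forall S : {set G}, independent S -> #|S| <= a) ->
    #|G| <= q.+1 * q.+3.
  move=> aq /(colorable_card_bound Gq) Ga; apply: leq_trans Ga _.
  by rewrite leq_mul2l aq orbT.
case: Fgood GF => -> GF.
- by apply: (small 3) => // S; apply: co_K4_free_independent.
- by apply: leq_trans (P4_free_critical_card Gcrit GF) _; rewrite leq_pmulr.
- apply: (small q.+1) => [|S]; first by rewrite ltnW.
  exact: P2_2P1_free_critical_independent.
by apply: (small 2) => // S; apply: P3_P1_free_critical_independent Gcrit GF.
Qed.

(** * Graphs on at most four vertices *)

Definition K3 : sgraph := complete_graph 3.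
Definition two_P2 : sgraph := copies 2 (path_graph 2).
(** The two pairs of opposite vertices of C_4 are the edges of 2P_2. *)
Definition C4 : sgraph := compl_graph two_P2.
Definition claw : sgraph :=
  compl_graph (disjoint_union (complete_graph 3) (complete_graph 1)).

Definition K3_seq : seq K3 := [:: 'o_3 0; 'o_3 1; 'o_3 2].
Definition two_P2_seq : seq two_P2 :=
  [:: ('o_2 0, 'o_2 0); ('o_2 0, 'o_2 1); ('o_2 1, 'o_2 0); ('o_2 1, 'o_2 1)].
Definition C4_seq : seq C4 := two_P2_seq.
Definition claw_seq : seq claw :=
  [:: inr 'o_1 0; inl 'o_3 0; inl 'o_3 1; inl 'o_3 2].

Lemma mem_K3_seq x : x \in K3_seq.
Proof. by apply: uniq_size_card_mem; rewrite ?card_ord. Qed.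

Lemma mem_two_P2_seq x : x \in two_P2_seq.
Proof. by apply: uniq_size_card_mem; rewrite ?card_prod ?card_ord. Qed.

Lemma mem_claw_seq x : x \in claw_seq.
Proof. by apply: uniq_size_card_mem; rewrite ?card_sum ?card_ord. Qed.

Definition bad_matrices :=
  [:: adjacency K3_seq; adjacency two_P2_seq;
      adjacency C4_seq; adjacency claw_seq].
Definition good_matrices :=
  [:: adjacency co_K4_seq; adjacency P4_seq;
      adjacency P2_2P1_seq; adjacency P3_P1_seq].

Definition small_matrix_ok M :=
  has (fun N => embeds N M) bad_matrices || has (embeds M) good_matrices.

Lemma small_matrix_okP (H : sgraph) (s : seq H) :
  size s <= 4 -> small_matrix_ok (adjacency s).
Proof.
case: s => [|x [|y [|z [|w []]]]] // _; rewrite /adjacency /= !sedge_irr.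
- by vm_compute.
- by rewrite [y -- x]sedge_sym; case: (_ -- _); vm_compute.
- rewrite [y -- x]sedge_sym ![z -- _]sedge_sym.
  by case: (_ -- _); case: (_ -- _); case: (_ -- _); vm_compute.
rewrite [y -- x]sedge_sym ![z -- _]sedge_sym ![w -- _]sedge_sym.
by do 6 case: (_ -- _); vm_compute.
Qed.

(** Both alternatives are decided on the adjacency matrix, of which there are
    at most 64 per order. *)
Lemma small_graph_dichotomy (H : sgraph) : #|H| <= 4 ->
  [\/ is_induced_subgraph K3 H, is_induced_subgraph two_P2 H,
      is_induced_subgraph C4 H | is_induced_subgraph claw H] \/
  [\/ is_induced_subgraph H co_K4, is_induced_subgraph H (path_graph 4),
      is_induced_subgraph H P2_2P1 | is_induced_subgraph H P3_P1].
Proof.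
rewrite cardE => /small_matrix_okP.
have Hmem x : x \in enum H by rewrite mem_enum.
have Hu : uniq (enum H) := enum_uniq _.
case/orP=> /hasP[N]; rewrite !inE => /or4P[] /eqP-> E;
  [left|left|left|left|right|right|right|right].
- by constructor 1; apply: embedsP mem_K3_seq Hu E.
- by constructor 2; apply: (@embedsP two_P2) mem_two_P2_seq Hu E.
- by constructor 3; apply: (@embedsP C4) mem_two_P2_seq Hu E.
- by constructor 4; apply: embedsP mem_claw_seq Hu E.
- by constructor 1; apply: embedsP Hmem _ E.
- by constructor 2; apply: embedsP Hmem _ E.
- by constructor 3; apply: embedsP Hmem _ E.
- by constructor 4; apply: embedsP Hmem _ E.
Qed.

(** * Difference graphs *)

Definition diff_adj (D : pred nat) (i j : nat) : bool :=
  (i < j) && D (j - i) || (j < i) && D (i - j).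

Lemma diff_adj_sym D i j : diff_adj D i j = diff_adj D j i.
Proof. by rewrite /diff_adj orbC. Qed.

Lemma diff_adj_irr D i : diff_adj D i i = false.
Proof. by rewrite /diff_adj ltnn. Qed.

Lemma diff_adj_lt D i j : i < j -> diff_adj D i j = D (j - i).
Proof. by move=> ij; rewrite /diff_adj ij [j < i]ltnNge ltnW //= orbF. Qed.

Lemma diff_adj_subn D a i j : a <= i -> a <= j ->
  diff_adj D (i - a) (j - a) = diff_adj D i j.
Proof. by move=> ai aj; rewrite /diff_adj !ltn_sub2rE // !subnBA // !subnK. Qed.

Definition diff_graph n (D : pred nat) : sgraph :=
  @SGraph 'I_n.+1 (fun i j => diff_adj D i j)
    (fun i j => diff_adj_sym D i j) (fun i => diff_adj_irr D i).

Lemma diff_graph_edge n (D : pred nat) (i j : diff_graph n D) :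
  i < j -> (i -- j) = D (j - i).
Proof. exact: diff_adj_lt. Qed.

(** The vertices i, ..., i + q cannot all have different colours, and the only
    two of them that may be non-adjacent are i and i + q. Hence a q-colouring
    has period q and agrees on the adjacent vertices 0 and q * p. *)
Lemma diff_graph_not_colorable q p (D : pred nat) :
  (forall d, 0 < d < q -> D d) -> D (q * p) -> 0 < q -> 0 < p ->
  ~ colorable_on [set: diff_graph (q * p) D] q.
Proof.
move=> Dq Dqp q_gt0 p_gt0 [c cq cP].
pose G := diff_graph (q * p) D.
pose v i : G := inord i.
have vE i : i <= q * p -> v i = i :> nat by move=> ile; rewrite inordK.
have vedge i j : i < j -> j <= q * p -> D (j - i) -> c (v i) <> c (v j).
  move=> ij jle Dij; apply: cP; rewrite ?inE // diff_graph_edge ?vE //;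
  exact: leq_trans (ltnW ij) jle.
have step i : i + q <= q * p -> c (v i) = c (v (i + q)).
  move=> iq; pose d (t : 'I_q.+1) := c (v (i + t)).
  have [||t [u [_ _]]] := @color_pigeonhole _ d [set: 'I_q.+1] q.
  - by move=> t _; apply: cq; rewrite inE.
  - by rewrite cardsT card_ord.
  wlog tu : t u / t < u.
    move=> IH tu dtu; have := tu.
    rewrite -(inj_eq val_inj) neq_ltn => /orP[] lt.
      exact: IH lt tu dtu.
    by apply: IH lt _ (esym dtu); rewrite eq_sym.
  move=> _; have := ltn_ord u; rewrite ltnS leq_eqVlt => uq dtu.
  have [tu_q|] := ltnP (u - t) q.
    case: (@vedge (i + t) (i + u) _ _ _ dtu); [lia|lia|].
    by apply: Dq; lia.
  move=> q_tu; have [t0 uq'] : t = 0 :> nat /\ u = q :> nat by lia.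
  by move: dtu; rewrite /d t0 uq' addn0.
have iter t : t <= p -> c (v 0) = c (v (q * t)).
  elim: t => [|t IHt] tp; first by rewrite muln0.
  rewrite (IHt (ltnW tp)) mulnS addnC; apply: step.
  by rewrite addnC -mulnS leq_mul2l tp orbT.
by apply: (@vedge 0 (q * p)); rewrite ?subn0 ?muln_gt0 ?q_gt0 //; exact: iter.
Qed.

(** Colour i by its residue modulo q, lowered by one beyond j. Two vertices on
    the same side of j with equal colours differ by a multiple of q other than
    q * p; on opposite sides their difference is 1 modulo q but not 1. Neither
    difference belongs to D. *)
Lemma diff_graph_del_colorable q p (D : pred nat) (j : diff_graph (q * p) D) :
  1 < q -> (forall d, D d -> d %% q <= 1 -> d = 1 \/ d = q * p) ->
  colorable_on [set~ j] q.
Proof.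
move=> q_gt1 DP; pose c (i : diff_graph (q * p) D) := (i - (j < i)) %% q.
have q_gt0 := ltnW q_gt1.
have key (x y : diff_graph (q * p) D) : x \in [set~ j] -> y \in [set~ j] ->
    x < y -> x -- y -> c x <> c y.
  rewrite !inE -!(inj_eq val_inj) => xj yj xy.
  rewrite diff_graph_edge // => Dxy cxy.
  rewrite /= in xj yj.
  have [yn jn] := (ltn_ord y, ltn_ord j).
  have x_le : x - (j < x) <= y - (j < y) by lia.
  have mod0 : (y - (j < y) - (x - (j < x))) %% q = 0.
    by apply/eqP; rewrite -/(dvdn _ _) -eqn_mod_dvd //; apply/eqP.
  have [[eyx side]|[xj' jy]] :
      (y - (j < y) - (x - (j < x)) = y - x /\ (j < x) = (j < y)) \/
      (x < j /\ j < y) by lia.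
    have le1 : (y - x) %% q <= 1 by rewrite -eyx mod0.
    have [e1|e2] := DP _ Dxy le1.
      by move: mod0; rewrite eyx e1 modn_small.
    lia.
  have e : y - x = (y - (j < y) - (x - (j < x))) + 1 by lia.
  have yx1 : (y - x) %% q = 1 by rewrite e -modnDml mod0 modn_small.
  have [e1|e2] := DP _ Dxy (eq_leq yx1); first lia.
  by move: yx1; rewrite e2 modnMr.
exists c => [i _|x y xj yj xy]; first exact: ltn_pmod.
have := sedge_neq xy; rewrite -(inj_eq val_inj) neq_ltn => /orP[] lt.
  exact: key.
by apply/nesym/key; rewrite // sedge_sym.
Qed.

Lemma diff_graph_small_colorable q p (D : pred nat)
    (S : {set diff_graph (q * p) D}) :
  1 < q -> (forall d, D d -> d %% q <= 1 -> d = 1 \/ d = q * p) ->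
  #|S| <= q * p -> colorable_on S q.
Proof.
move=> q_gt1 DP Sqp.
have /card_gt0P[j] : 0 < #|~: S|.
  by rewrite cardsCs setCK card_ord subn_gt0 ltnS.
rewrite inE => jS.
apply: colorable_on_mono (diff_graph_del_colorable j q_gt1 DP) => //.
by apply/subsetP=> x xS; rewrite !inE; apply: contraNneq jS => <-.
Qed.

(** The least and the greatest set of differences to which
    diff_graph_not_colorable and diff_graph_del_colorable apply. *)
Definition short_diff q n : pred nat := fun d => (0 < d < q) || (d == n).
Definition residue_diff q n : pred nat :=
  fun d => [|| d == 1, d == n | 1 < d %% q].

Lemma short_diff_adj q n i j :
  i <= n -> j <= n -> diff_adj (short_diff q n) i j ->
  (i <> j /\ i < j + q /\ j < i + q) \/ (i = 0 /\ j = n) \/ (i = n /\ j = 0).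
Proof.
rewrite /diff_adj /short_diff => i_le j_le.
case/orP=> /andP[ij /orP[/andP[_ short]|/eqP long]]; lia.
Qed.

Lemma short_diff_nadj q n i j :
  i != j -> ~~ diff_adj (short_diff q n) i j -> i + q <= j \/ j + q <= i.
Proof. rewrite /diff_adj /short_diff => ij; lia. Qed.

(** Without the edge between 0 and n this is a power of a path, an interval
    graph; the condition on n keeps that edge out of every 4-cycle. *)
Lemma short_diff_no_C4 q n a b c d :
  0 < q -> 3 * q <= n -> a <= n -> b <= n -> c <= n -> d <= n ->
  a != c -> b != d ->
  let adj := diff_adj (short_diff q n) in
  adj a b -> adj b c -> adj c d -> adj d a -> ~~ adj a c -> ~~ adj b d -> False.
Proof.
move=> q0 qn an bn cn dn ac bd adj.
move=> /(short_diff_adj an bn) ab /(short_diff_adj bn cn) bc.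
move=> /(short_diff_adj cn dn) cd /(short_diff_adj dn an) da.
move=> /(short_diff_nadj ac) {}ac /(short_diff_nadj bd) {}bd.
lia.
Qed.

(** Short neighbours of x lie in two cliques, one on each side of x. At an end
    of the path one side is empty and the long edge takes its place. *)
Lemma short_diff_no_claw q n x a b c :
  0 < q -> 3 * q <= n -> x <= n -> a <= n -> b <= n -> c <= n ->
  a != b -> a != c -> b != c ->
  let adj := diff_adj (short_diff q n) in
  adj x a -> adj x b -> adj x c ->
  ~~ adj a b -> ~~ adj a c -> ~~ adj b c -> False.
Proof.
move=> q0 qn xn an bn cn ab ac bc adj.
move=> /(short_diff_adj xn an) xa /(short_diff_adj xn bn) xb.
move=> /(short_diff_adj xn cn) xc /(short_diff_nadj ab) {}ab.
move=> /(short_diff_nadj ac) {}ac /(short_diff_nadj bc) {}bc.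
lia.
Qed.

(** Adjacency in terms of residues of the endpoints, in a form linear in them:
    r is the residue of j - i, and the second and third alternatives of an edge
    are the differences 1 and n. *)
Lemma residue_diffP q n i j : i < j -> 2 < q -> n %% q = 0 ->
  exists r,
    (i %% q <= j %% q /\ r + i %% q = j %% q \/
     j %% q < i %% q /\ r + i %% q = q + j %% q) /\
    if residue_diff q n (j - i)
    then 1 < r \/ (r = 1 /\ j = i.+1) \/ (r = 0 /\ j = i + n)
    else r <= 1 /\ j <> i.+1 /\ j <> i + n.
Proof.
move=> ij q_gt2 nq; have q_gt0 : 0 < q by lia.
exists ((j - i) %% q); split.
  have iq := ltn_pmod i q_gt0; rewrite modnB // ?(ltnW ij) //.
  case: (ltnP (j %% q) (i %% q)) => ji; rewrite ?mul1n ?mul0n.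
    by right; lia.
  by left; lia.
rewrite /residue_diff; case: ifP => [/or3P[/eqP e|/eqP e|]|].
- by right; left; split; [rewrite e modn_small //; lia|lia].
- by right; right; split; [rewrite e|lia].
- by left.
by move=> /negbT; rewrite !negb_or -leqNgt => /and3P[/eqP ? /eqP ? ?]; lia.
Qed.

(** An induced 2P_2 on 0, b, c, d with edges 0c and bd, where 0 is least and
    b < d. As b and d are not adjacent to 0, their residues are 0 or 1, and
    adjacency of b and d leaves two possibilities: d = b + 1 with residues 0
    and 1, or residues 1 and 0. In either case non-adjacency of c to b and d
    forces residue 0 on a c smaller than n, or residue 1 on a c greater than 1,
    against the edge 0c; q > 3 keeps the residues -1 and 2 apart. *)
Lemma residue_diff_no_2P2_from0 q n b c d :
  3 < q -> n %% q = 0 -> c <= n -> d <= n -> 0 < b -> b < d ->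
  c != b -> c != d ->
  let adj := diff_adj (residue_diff q n) in
  residue_diff q n c -> ~~ residue_diff q n b -> ~~ residue_diff q n d ->
  adj b d -> ~~ adj c b -> ~~ adj c d -> False.
Proof.
move=> q_gt3 nq cn dn b0 bd cb cd adj Ec Eb Ed.
have q2 : 2 < q by apply: ltnW.
have q0 : 0 < q by apply: ltnW (ltnW q2).
have {Ec} cE : 1 < c %% q \/ c %% q = 1 /\ c = 1 \/ c %% q = 0 /\ c = n.
  case/or3P: Ec => [/eqP->|/eqP->|]; [right; left|right; right|by left] => //.
  by rewrite modn_small // ltnW.
have nE x : ~~ residue_diff q n x -> x <> 1 /\ x <> n /\ x %% q <= 1.
  by rewrite !negb_or -leqNgt => /and3P[/eqP ? /eqP ? ?].
have [b1 [bn bE]] := nE _ Eb; have [d1 [dn' dE]] := nE _ Ed.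
have [rb rc rd] := And3 (ltn_pmod b q0) (ltn_pmod c q0) (ltn_pmod d q0).
have [r4 [m4]] := residue_diffP bd q2 nq.
rewrite /adj diff_adj_lt // => p4 Ebd; move: p4; rewrite Ebd => p4.
have {r4 m4 p4} bdE :
    (b %% q = 0 /\ d %% q = 1 /\ d = b.+1) \/ (b %% q = 1 /\ d %% q = 0).
  clear - rb rd bE dE m4 p4 b0 bd dn q_gt3.
  move: (b %% q) (d %% q) rb rd bE dE m4 p4.
  lia.
clear Ebd Eb Ed nE bE dE bn dn' b1 d1.
case: (ltngtP c b) cb => // [cb|bc] _; case: (ltngtP c d) cd => // [cd|dc] _.
- rewrite !diff_adj_lt // => /negbTE Ecb /negbTE Ecd.
  have [r5 [m5]] := residue_diffP cb q2 nq; rewrite Ecb => p5.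
  have [r6 [m6]] := residue_diffP cd q2 nq; rewrite Ecd => p6.
  clear Ecb Ecd adj.
  move: (b %% q) (c %% q) (d %% q) rb rc rd bdE m5 p5 m6 p6 cE.
  lia.
- by have := ltn_trans bd (ltn_trans dc cb); rewrite ltnn.
- rewrite diff_adj_sym !diff_adj_lt // => /negbTE Ecb /negbTE Ecd.
  have [r5 [m5]] := residue_diffP bc q2 nq; rewrite Ecb => p5.
  have [r6 [m6]] := residue_diffP cd q2 nq; rewrite Ecd => p6.
  clear Ecb Ecd adj.
  move: (b %% q) (c %% q) (d %% q) rb rc rd bdE m5 p5 m6 p6 cE.
  lia.
rewrite ![diff_adj _ c _]diff_adj_sym !diff_adj_lt //.
move=> /negbTE Ecb /negbTE Ecd.
have [r5 [m5]] := residue_diffP bc q2 nq; rewrite Ecb => p5.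
have [r6 [m6]] := residue_diffP dc q2 nq; rewrite Ecd => p6.
clear Ecb Ecd adj.
move: (b %% q) (c %% q) (d %% q) rb rc rd bdE m5 p5 m6 p6 cE.
lia.
Qed.

(** Adjacency depends on differences only, so the least vertex may be moved to
    0, and the symmetries of 2P_2 let any of its vertices play that role. *)
Lemma residue_diff_no_2P2 q n a b c d :
  3 < q -> n %% q = 0 -> a <= n -> b <= n -> c <= n -> d <= n ->
  a != b -> a != d -> c != b -> c != d ->
  let adj := diff_adj (residue_diff q n) in
  adj a c -> adj b d ->
  ~~ adj a b -> ~~ adj a d -> ~~ adj c b -> ~~ adj c d -> False.
Proof.
move=> q_gt3 nq an bn cn dn ab ad cb cd adj.
have adjC x y : adj x y = adj y x by apply: diff_adj_sym.
have irr x : adj x x = false by apply: diff_adj_irr.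
have least x y z t : y <= n -> t <= n -> z <= n -> x < y -> y < z -> x < t ->
    t != y -> t != z -> adj x t -> adj y z ->
    ~~ adj x y -> ~~ adj x z -> ~~ adj t y -> ~~ adj t z -> False.
  move=> yn tn zn xy yz xt ty tz xt_e yz_e xy_e xz_e ty_e tz_e.
  have xz := ltn_trans xy yz.
  apply: (@residue_diff_no_2P2_from0 q n (y - x) (t - x) (z - x)) => //;
    rewrite ?diff_adj_subn // ?(ltnW xy, ltnW xz, ltnW xt) //.
  - exact: leq_trans (leq_subr _ _) tn.
  - exact: leq_trans (leq_subr _ _) zn.
  - by rewrite subn_gt0.
  - exact: ltn_sub2r.
  - by rewrite eqn_sub2rE // ltnW.
  - by rewrite eqn_sub2rE // ltnW.
  - by rewrite -diff_adj_lt.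
  - by rewrite -diff_adj_lt.
  - by rewrite -diff_adj_lt.
have least2 x y z t : y <= n -> t <= n -> z <= n -> x < y -> x < z -> x < t ->
    t != y -> t != z -> adj x t -> adj y z ->
    ~~ adj x y -> ~~ adj x z -> ~~ adj t y -> ~~ adj t z -> False.
  move=> yn tn zn xy xz xt ty tz xt_e yz_e xy_e xz_e ty_e tz_e.
  case: (ltngtP y z) => [yz|zy|yz].
  - exact: (least x y z t).
  - by apply: (least x z y t); rewrite // adjC.
  - by rewrite yz irr in yz_e.
move=> ac_e bd_e ab_e ad_e cb_e cd_e.
have ac : a != c by apply: contraTneq ac_e => ->; rewrite irr.
have bd : b != d by apply: contraTneq bd_e => ->; rewrite irr.
have [amin|[bmin|[cmin|dmin]]] :
   (a < b /\ a < c /\ a < d) \/ (b < a /\ b < c /\ b < d) \/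
   (c < a /\ c < b /\ c < d) \/ (d < a /\ d < b /\ d < c) by lia.
- case: amin => ? [? ?]; apply: (least2 a b d c) => //;
  by [rewrite eq_sym|rewrite adjC].
- case: bmin => ? [? ?]; apply: (least2 b a c d) => //;
  by [rewrite eq_sym|rewrite adjC].
- case: cmin => ? [? ?]; apply: (least2 c b d a) => //;
  by [rewrite eq_sym|rewrite adjC].
case: dmin => ? [? ?]; apply: (least2 d a c b) => //;
  by [rewrite eq_sym|rewrite adjC].
Qed.

Lemma C4_free_short_diff q n :
  0 < q -> 3 * q <= n -> is_free C4 (diff_graph n (short_diff q n)).
Proof.
move=> q0 qn /induced_subgraphP[f finj fe].
have e x y : diff_adj (short_diff q n) (f x) (f y) = x -- y.
  by rewrite -(fe x y).
have le x : f x <= n by rewrite -ltnS.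
apply: (@short_diff_no_C4 q n (f ('o_2 0, 'o_2 0)) (f ('o_2 1, 'o_2 0))
  (f ('o_2 0, 'o_2 1)) (f ('o_2 1, 'o_2 1))); rewrite ?e //;
by rewrite (inj_eq val_inj) (inj_eq finj).
Qed.

Lemma claw_free_short_diff q n :
  0 < q -> 3 * q <= n -> is_free claw (diff_graph n (short_diff q n)).
Proof.
move=> q0 qn /induced_subgraphP[f finj fe].
have e x y : diff_adj (short_diff q n) (f x) (f y) = x -- y.
  by rewrite -(fe x y).
have le x : f x <= n by rewrite -ltnS.
apply: (@short_diff_no_claw q n (f (inr 'o_1 0)) (f (inl 'o_3 0))
  (f (inl 'o_3 1)) (f (inl 'o_3 2))); rewrite ?e //;
by rewrite (inj_eq val_inj) (inj_eq finj).
Qed.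

Lemma two_P2_free_residue_diff q n :
  3 < q -> n %% q = 0 -> is_free two_P2 (diff_graph n (residue_diff q n)).
Proof.
move=> q3 qn /induced_subgraphP[f finj fe].
have e x y : diff_adj (residue_diff q n) (f x) (f y) = x -- y.
  by rewrite -(fe x y).
have le x : f x <= n by rewrite -ltnS.
apply: (@residue_diff_no_2P2 q n (f ('o_2 0, 'o_2 0)) (f ('o_2 1, 'o_2 0))
  (f ('o_2 0, 'o_2 1)) (f ('o_2 1, 'o_2 1))); rewrite ?e //;
by rewrite (inj_eq val_inj) (inj_eq finj).
Qed.

(** The parameter p is free, and the graphs have q * p + 1 vertices. *)
Lemma unbounded_diff_graph F q (D : nat -> pred nat) :
  1 < q -> (forall p d, 0 < d < q -> D p d) -> (forall p, D p (q * p)) ->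
  (forall p d, D p d -> d %% q <= 1 -> d = 1 \/ d = q * p) ->
  (forall p, 2 < p -> is_free F (diff_graph (q * p) (D p))) ->
  ~ finitely_many_up_to_iso (fun G => vertex_critical q.+1 G /\ is_free F G).
Proof.
move=> q1 Dq Dqp DP DF; apply: unbounded_critical => N.
exists (diff_graph (q * N.+3) (D N.+3)); split; first exact: DF.
  by apply: diff_graph_not_colorable => //; [exact: Dq|exact: ltnW].
move=> S SN; apply: diff_graph_small_colorable => //; first exact: DP.
apply: leq_trans SN _; rewrite -[N]mul1n leq_mul // ?mul1n; lia.
Qed.

Lemma short_diff_residue q n d : 1 < q ->
  short_diff q n d -> d %% q <= 1 -> d = 1 \/ d = n.
Proof.
move=> q1 /orP[/andP[d0 dq]|/eqP]; last by right.
by rewrite modn_small //; left; lia.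
Qed.

Lemma infinitely_many_C4_free q : 1 < q ->
  ~ finitely_many_up_to_iso (fun G => vertex_critical q.+1 G /\ is_free C4 G).
Proof.
move=> q1.
apply: (@unbounded_diff_graph _ q (fun p => short_diff q (q * p))) => //.
- by move=> p d; rewrite /short_diff => ->.
- by move=> p; rewrite /short_diff eqxx orbT.
- by move=> p d; apply: short_diff_residue.
move=> p p2; apply: C4_free_short_diff; first exact: ltnW.
by rewrite 1?mulnC leq_mul2l p2 orbT.
Qed.

Lemma infinitely_many_claw_free q : 1 < q ->
  ~ finitely_many_up_to_iso (fun G => vertex_critical q.+1 G /\ is_free claw G).
Proof.
move=> q1.
apply: (@unbounded_diff_graph _ q (fun p => short_diff q (q * p))) => //.
- by move=> p d; rewrite /short_diff => ->.
- by move=> p; rewrite /short_diff eqxx orbT.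
- by move=> p d; apply: short_diff_residue.
move=> p p2; apply: claw_free_short_diff; first exact: ltnW.
by rewrite 1?mulnC leq_mul2l p2 orbT.
Qed.

Lemma infinitely_many_two_P2_free q : 3 < q ->
  ~ finitely_many_up_to_iso
      (fun G => vertex_critical q.+1 G /\ is_free two_P2 G).
Proof.
move=> q3; apply: (@unbounded_diff_graph _ q (fun p => residue_diff q (q * p))).
- by lia.
- move=> p d dq; rewrite /residue_diff modn_small; lia.
- by move=> p; rewrite /residue_diff eqxx orbT.
- by move=> p d /or3P[/eqP|/eqP|]; [left|right|rewrite ltnNge => /negP].
by move=> p _; apply: two_P2_free_residue_diff => //; rewrite modnMr.
Qed.

(** * Triangle-free critical graphs *)

Definition triangle_free (G : sgraph) : Prop :=
  forall a b c : G, a -- b -> b -- c -> a -- c -> False.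

Lemma triangle_freeW (G : sgraph) : triangle_free G -> is_free K3 G.
Proof.
move=> GT /induced_subgraphP[f _ fe].
by apply: (GT (f 'o_3 0) (f 'o_3 1) (f 'o_3 2)); rewrite fe.
Qed.

Definition shift_graph n : sgraph :=
  arc_graph (fun u v : 'I_n * 'I_n => [&& u.1 < u.2, u.2 == v.1 & v.1 < v.2]).

Lemma shift_graph_triangle_free n : triangle_free (shift_graph n).
Proof.
move=> [a a'] [b b'] [c c']; rewrite /= /arc_edge /=.
move=> /andP[_ +] /andP[_ +] /andP[_ +].
by do 3 case/orP=> /and3P[? /eqP/(congr1 val)/= ? ?]; lia.
Qed.

(** Let A i be the set of colours of the pairs (i, j). For i < j the colour of
    (i, j) lies in A i but not in A j, since (i, j) is adjacent to every
    (j, l). So A is injective into the subsets of the q colours. *)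
Lemma shift_graph_not_colorable n q :
  2 ^ q < n -> ~ colorable_on [set: shift_graph n] q.
Proof.
move=> qn [c cq cP].
pose A (i : 'I_n) : {set 'I_q} :=
  [set a : 'I_q | [exists j : 'I_n, (i < j) && (c (i, j) == a)]].
have A_inj : injective A.
  have A_lt (i j : 'I_n) : i < j -> A i <> A j.
    move=> ij Aij; pose a := Ordinal (cq (i, j) (in_setT _)).
    have : a \in A i by rewrite inE; apply/existsP; exists j; rewrite ij /=.
    rewrite Aij inE => /existsP[l /andP[jl /eqP cjl]].
    apply: (cP (i, j) (j, l)); rewrite ?inE //= /arc_edge /= ij jl eqxx andbT.
    by rewrite xpair_eqE negb_and -!(inj_eq val_inj) /= ltn_eqF.
  move=> i j Aij; apply/val_inj; case: (ltngtP i j) => // [ij|ji].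
    by case: (A_lt _ _ ij).
  by case: (A_lt _ _ ji).
have := leq_card A A_inj.
by rewrite card_ord -cardsT -powersetT card_powerset cardsT card_ord leqNgt qn.
Qed.

(** Take a minimal set of arcs whose graph is not q-colourable; deleting one
    arc gives a q-colouring, and the ends of that arc must be its only
    conflict. *)
Lemma edge_critical_spanning (G : sgraph) q :
  0 < q -> triangle_free G -> ~ colorable_on [set: G] q ->
  exists (M : sgraph) (x y : M),
    [/\ triangle_free M, ~ colorable_on [set: M] q, x != y &
      exists c : M -> nat, [/\ forall u, c u < q, c x = c y &
        forall u v, u -- v -> c u = c v -> (u, v) = (x, y) \/ (u, v) = (y, x)]].
Proof.
move=> q0 GT Gq.
pose M (A : {set G * G}) :=
  arc_graph (fun u v : G => (u -- v) && ((u, v) \in A)).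
pose bad A := ~~ colorable (M A) q.
have MT A : triangle_free (M A).
  have ME (u v : M A) : u -- v -> (u : G) -- (v : G).
    by rewrite /= /arc_edge => /andP[_ /orP[]] /andP[] //; rewrite sedge_sym.
  by move=> a b c /ME ab /ME bc /ME ac; apply: GT ab bc ac.
have [A /minsetP[Abad Amin]] : {A | minset bad A}.
  have [|A ? _] := @minset_exists _ bad setT; last by exists A.
  apply/negP=> /colorableP[c cq cP]; apply: Gq; exists c => // u v _ _ uv.
  apply: cP; rewrite ?inE //= /arc_edge !inE !andbT uv.
  by rewrite sedge_neq.
have Aq : ~ colorable_on [set: M A] q by move/colorableP; apply/negP.
have [A0|[[x y] xyA]] := set_0Vmem A.
  case: Aq; exists (fun=> 0) => // u v _ _.
  by rewrite /= /arc_edge A0 !inE !andbF.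
have /colorableP[c cq cP] : colorable (M (A :\ (x, y))) q.
  apply: contraT => /Amin/(_ (subsetDl _ _))/setP/(_ (x, y)).
  by rewrite !inE eqxx xyA.
have cE (u v : M A) : u -- v -> c u = c v -> (u, v) = (x, y) \/ (u, v) = (y, x).
  rewrite /= /arc_edge => /andP[uv uvA] cuv.
  have [|uv1] := eqVneq (u, v) (x, y); first by left.
  have [[-> ->]|uv2] := eqVneq (v, u) (x, y); first by right.
  case: (cP u v); rewrite ?inE //= /arc_edge uv !inE uv1 uv2; exact: uvA.
(* If x = y or c x differs from c y, then c has no conflict at all on M A. *)
have mono : ~ (x == y) || (c x != c y).
  move=> bad_xy; apply: Aq; exists c => // u v _ _ uv cuv.
  by have [[ux vy]|[uy vx]] := cE u v uv cuv; subst u v; move: bad_xy;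
    rewrite cuv eqxx orbF => /eqP E; rewrite E sedge_irr in uv.
exists (M A), x, y; split=> //.
  by apply/negP=> xy; apply: mono; rewrite xy.
exists c; split=> // [u|]; first exact: cq.
by apply/eqP; apply: contraPT mono => ->; rewrite orbT.
Qed.

(** Copies 0, ..., m of M without the edge xy. Gluing is done without a
    quotient: the vertex y of copy i is represented by x of copy i + 1 (second
    kind of arc), and the vertices (i, y) themselves are isolated. The third
    kind of arc closes the chain. *)
Definition chain_arc (M : sgraph) (x y : M) (m : nat) :
    rel ('I_m.+1 * M) := fun u v =>
  [|| [&& u.1 == v.1, u.2 -- v.2, u.2 != y & v.2 != y],
      [&& u.1.+1 == v.1 :> nat, u.2 -- y, u.2 != x & v.2 == x]
    | [&& u.1 == 0 :> nat, v.1 == m :> nat, u.2 == x & v.2 == x]].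

Definition chain (M : sgraph) (x y : M) (m : nat) : sgraph :=
  arc_graph (@chain_arc M x y m).

(** If x had different colours in copies i and i + 1, reading the latter as the
    colour of y would give a q-colouring of M. So x has the same colour in all
    copies, against the closing edge. *)
Lemma chain_not_colorable (M : sgraph) (x y : M) m q :
  0 < m -> x != y -> ~ colorable_on [set: M] q ->
  ~ colorable_on [set: chain x y m] q.
Proof.
move=> m0 xy Mq [c cq cP].
have chain_edge (u v : chain x y m) : u != v -> chain_arc x y u v -> c u <> c v.
  by move=> uv a; apply: cP; rewrite ?inE //= /arc_edge uv a.
have step i : i < m -> c (inord i, x) = c (inord i.+1, x).
  move=> im; apply/eqP; apply: contraPT Mq => /eqP cx; apply.
  have iE : (inord i : 'I_m.+1) = i :> nat by rewrite inordK // ltnW.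
  have i1E : (inord i.+1 : 'I_m.+1) = i.+1 :> nat by rewrite inordK.
  have ii : inord i != inord i.+1 :> 'I_m.+1.
    by rewrite -(inj_eq val_inj) /= iE i1E ltn_eqF.
  pose d u := if u == y then c (inord i.+1, x) else c (inord i, u).
  have dy u : u != y -> u -- y -> c (inord i, u) <> c (inord i.+1, x).
    move=> uy u_y; have [->//|ux] := eqVneq u x.
    apply: chain_edge; first by rewrite xpair_eqE negb_and ii.
    by rewrite /chain_arc /= iE i1E !eqxx u_y ux orbT.
  exists d => [u _|u v _ _ uv]; first by rewrite /d; case: ifP => _; apply: cq.
  rewrite /d; case: (eqVneq u y) => [uy|uy]; case: (eqVneq v y) => [vy|vy].
  - by rewrite uy vy sedge_irr in uv.
  - by apply/nesym/dy; rewrite // sedge_sym -uy.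
  - by apply: dy; rewrite // -vy.
  apply: chain_edge; first by rewrite xpair_eqE negb_and (sedge_neq uv) orbT.
  by rewrite /chain_arc /= eqxx uv uy vy.
have const i : i <= m -> c (inord 0, x) = c (inord i, x).
  by elim: i => [|i IHi] im; last exact: etrans (IHi (ltnW im)) (step _ im).
apply: (chain_edge _ _ _ _ (const _ (leqnn m))).
  by rewrite xpair_eqE negb_and -(inj_eq val_inj) /= !inordK // eq_sym -lt0n m0.
by rewrite /chain_arc /= !inordK // !eqxx !orbT.
Qed.

(** A set of at most m vertices misses one of the m + 1 copies, say copy i. Use
    c on the copies before i, and c followed by a cyclic shift of the colours
    on those after i: the two ends of the chain then receive different
    colours, and no edge other than the closing one jumps over copy i. *)
Lemma chain_small_colorable (M : sgraph) (x y : M) m q (c : M -> nat)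
    (S : {set chain x y m}) :
  1 < q -> (forall u, c u < q) -> c x = c y ->
  (forall u v, u -- v -> c u = c v -> (u, v) = (x, y) \/ (u, v) = (y, x)) ->
  #|S| <= m -> colorable_on S q.
Proof.
move=> q1 cq cxy cP Sm.
have [i iS] : exists i : 'I_m.+1, forall u, u \in S -> u.1 != i.
  have [/existsP[i /forall_inP iS]|] :=
    boolP [exists i, [forall u in S, u.1 != i]].
    by exists i.
  rewrite negb_exists => /forallP none.
  have : [set: 'I_m.+1] \subset [set u.1 | u : chain x y m in S].
    apply/subsetP=> i _; have := none i; rewrite negb_forall => /existsP[u].
    by rewrite negb_imply negbK => /andP[uS /eqP <-]; apply: imset_f.
  move=> /subset_leq_card; rewrite cardsT card_ord.
  move=> /leq_trans/(_ (leq_imset_card _ _)).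
  by rewrite ltnNge Sm.
have q0 := ltnW q1.
pose rot a := a.+1 %% q.
have rot_neq a : a < q -> rot a <> a.
  rewrite leq_eqVlt /rot => /orP[/eqP e|aq]; last by rewrite modn_small //; lia.
  by rewrite e modnn => a0; rewrite -a0 in e; rewrite -e in q1.
have rot_inj a b : a < q -> b < q -> rot a = rot b -> a = b.
  move=> aq bq /eqP; rewrite /rot -[a.+1]addn1 -[b.+1]addn1 eqn_modDr.
  by rewrite !modn_small // => /eqP.
pose d (u : chain x y m) := if u.1 < i then c u.2 else rot (c u.2).
have side (u v : chain x y m) :
    (u.1 < i) = (v.1 < i) -> c u.2 <> c v.2 -> d u <> d v.
  by rewrite /d => <- cuv; case: ifP => // _ /(rot_inj _ _ (cq _) (cq _)).
have dP (u v : chain x y m) :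
    u \in S -> v \in S -> chain_arc x y u v -> d u <> d v.
  move=> /iS/eqP uS /iS/eqP vS /or3P[].
  - case/and4P=> /eqP uv1 uv uy vy; apply: side; first by rewrite uv1.
    by move=> /(cP _ _ uv)[] [e1 e2]; rewrite ?e1 ?e2 eqxx in uy vy.
  - case/and4P=> /eqP uv1 u_y ux /eqP vx; apply: side.
      have : v.1 != i :> nat by apply/eqP=> /val_inj.
      by rewrite -uv1 [(_.+1 < i)]ltn_neqAle => ->.
    rewrite vx cxy => /(cP _ _ u_y)[]; first by case=> e; rewrite e eqxx in ux.
    by case=> e _; rewrite e sedge_irr in u_y.
  case/and4P=> /eqP u0 /eqP vm /eqP ux /eqP vx.
  have ui : u.1 < i.
    rewrite u0 lt0n; apply/eqP=> i0; apply: uS; apply/val_inj.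
    by rewrite /= u0 i0.
  have vi : (v.1 < i) = false by rewrite vm ltnNge -ltnS ltn_ord.
  by rewrite /d ui vi ux vx => /esym; apply: rot_neq.
exists d => [u _|u v uS vS].
  by rewrite /d; case: ifP => _ //; apply: ltn_pmod.
rewrite /= /arc_edge => /andP[_ /orP[] a]; first exact: dP.
by apply/nesym/dP.
Qed.

Lemma chain_edge_leq (M : sgraph) (x y : M) m (u v : chain x y m) :
  0 < m -> u.1 <= v.1 -> u -- v ->
  [\/ u.1 = v.1 :> nat /\ u.2 -- v.2,
      v.1 = u.1.+1 :> nat /\ u.2 -- y /\ v.2 = x
    | (u.1 = 0 :> nat /\ v.1 = m :> nat) /\ u.2 = x /\ v.2 = x].
Proof.
move=> m0 uv; rewrite /= /arc_edge => /andP[_ /orP[]] /or3P[] /and4P[].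
- by move=> /eqP e ? _ _; constructor 1; rewrite e.
- by move=> /eqP e ? _ /eqP ?; constructor 2; rewrite e.
- by move=> /eqP ? /eqP ? /eqP ? /eqP ?; constructor 3.
- by move=> /eqP e ? _ _; constructor 1; rewrite e sedge_sym.
- by move=> /eqP e; rewrite -e ltnn in uv.
by move=> /eqP e /eqP e'; move: uv; rewrite e e' leqNgt m0.
Qed.

(** With the vertices sorted by copy, comparing copy indices leaves a triangle
    inside M, two vertices of one copy adjacent to the next glueing vertex
    (which stands for y, giving a triangle of M), or two equal vertices. *)
Lemma chain_triangle_free (M : sgraph) (x y : M) m :
  2 < m -> triangle_free M -> triangle_free (chain x y m).
Proof.
move=> m2 MT.
have sorted (a b c : chain x y m) :
    a.1 <= b.1 -> b.1 <= c.1 -> a -- b -> b -- c -> a -- c -> False.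
  have m0 : 0 < m by lia.
  move=> ab bc /(chain_edge_leq m0 ab) eab /(chain_edge_leq m0 bc) ebc.
  move=> /(chain_edge_leq m0 (leq_trans ab bc)) eac {ab bc}.
  case: eab => -[ab1 ab2]; case: ebc => -[bc1 bc2];
    case: eac => -[ac1 ac2]; try lia.
  - exact: MT ab2 bc2 ac2.
  - by apply: MT ab2 _ _; [case: bc2 => e _; exact: e|case: ac2].
  - by case: bc2 ac2 => e1 _ [e2 _]; move: ab2; rewrite e1 e2 sedge_irr.
  - by case: ab2 ac2 => _ e1 [_ e2]; move: bc2; rewrite e1 e2 sedge_irr.
  - by case: ab2 ac2 => _ e1 [_ e2]; move: bc2; rewrite e1 e2 sedge_irr.
move=> a b c ab bc ac.
have [[ba cb] ca] : (b -- a /\ c -- b) /\ c -- a.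
  by rewrite !(sedge_sym c) sedge_sym.
case: (leqP a.1 b.1) => [abI|/ltnW baI];
  case: (leqP b.1 c.1) => [bcI|/ltnW cbI];
  case: (leqP a.1 c.1) => [acI|/ltnW caI].
- exact: (sorted a b c).
- exact: (sorted a b c).
- exact: (sorted a c b).
- exact: (sorted c a b).
- exact: (sorted b a c).
- exact: (sorted b c a).
- exact: (sorted c b a).
exact: (sorted c b a).
Qed.

Lemma infinitely_many_triangle_free q : 1 < q ->
  ~ finitely_many_up_to_iso (fun G => vertex_critical q.+1 G /\ is_free K3 G).
Proof.
move=> q1; apply: unbounded_critical => N.
have [M [x [y [MT Mq xy [c [cq cxy cP]]]]]] :=
  edge_critical_spanning (ltnW q1) (@shift_graph_triangle_free _)
    (@shift_graph_not_colorable (2 ^ q).+1 q (leqnn _)).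
exists (chain x y N.+3); split.
- exact/triangle_freeW/chain_triangle_free.
- exact: chain_not_colorable.
by move=> S SN; apply: (chain_small_colorable q1 cq cxy cP); lia.
Qed.

Theorem theorem1p1 (H : sgraph) (H_gt0 : 0 < #|H|) (H_le4 : #|H| <= 4)
    (k : nat) (k_ge5 : 5 <= k) :
  finitely_many_up_to_iso (fun G => vertex_critical k G /\ is_free H G) <->
  [\/ is_induced_subgraph H (compl_graph (complete_graph 4)),
      is_induced_subgraph H (path_graph 4),
      is_induced_subgraph H
        (disjoint_union (path_graph 2) (copies 2 (path_graph 1)))
    | is_induced_subgraph H (disjoint_union (path_graph 3) (path_graph 1))].
Proof.
case: k k_ge5 => // q; rewrite ltnS => q4.
have mono (F1 F2 : sgraph) : is_induced_subgraph F1 F2 ->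
    finitely_many_up_to_iso (fun G => vertex_critical q.+1 G /\ is_free F2 G) ->
    finitely_many_up_to_iso (fun G => vertex_critical q.+1 G /\ is_free F1 G).
  move=> F12 /finitely_manyP[N PN]; apply/finitely_manyP.
  exists N => G [Gcrit GF]; apply: PN; split=> // F2G; apply: GF.
  exact: induced_subgraph_trans F12 F2G.
split=> [Hfin|].
  have [[] FH|//] := small_graph_dichotomy H_le4; have := mono _ _ FH Hfin.
  - by move/infinitely_many_triangle_free; case; lia.
  - by move/infinitely_many_two_P2_free; case; lia.
  - by move/infinitely_many_C4_free; case; lia.
  - by move/infinitely_many_claw_free; case; lia.
by case=> /mono; apply; apply: finitely_many_free_critical;
  [constructor 1|constructor 2|constructor 3|constructor 4].
Qed.
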